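(* Let $R$ be the root system of type $C_n$ with Weyl group $WC_n$. Let $\vec\gamma=(\beta_1+C_{\beta_1},\dots,\beta_r+C_{\beta_r})\in\mathbb{R}^n$ be a rearranged vector (as described in the context), let $J\subseteq P(\vec\gamma)$, and let $((C_{\beta_1},J_{\beta_1}),\dots,(C_{\beta_r},J_{\beta_r}))$ be the corresponding book of placed configurations. For a standard tableau $t$ of this book define $w_t\in WC_n$ by $w_t(i)=t(\mathrm{box}_i)$, $1\le i\le n$. Then $t\mapsto w_t$ is a bijection from the set $\mathcal{F}^{((C_{\beta_1},J_{\beta_1}),\dots,(C_{\beta_r},J_{\beta_r}))}$ of standard tableaux of the book onto $\mathcal{F}^{(\vec\gamma,J)}$.
   Context: Type $C_n$: $\{\varepsilon_1,\dots,\varepsilon_n\}$ is an orthonormal basis of $\mathbb{R}^n$; $R^+=\{2\varepsilon_i\mid 1\le i\le n\}\cup\{\varepsilon_j\pm\varepsilon_i\mid 1\le i<j\le n\}$, $R=R^+\cup -R^+$. The Weyl group $WC_n$ is the group of permutations $w$ of $\{-n,\dots,-1,1,\dots,n\}$ with $w(-i)=-w(i)$, acting by $w\varepsilon_i=\varepsilon_{w(i)}$ with $\varepsilon_{-i}=-\varepsilon_i$. $R(w)=\{\alpha\in R^+\mid w\alpha\in -R^+\}$. Rearranged vectors. $\vec\gamma=(\vec\gamma_1,\dots,\vec\gamma_n)$ is a concatenation of blocks $\beta_1+C_{\beta_1},\dots,\beta_r+C_{\beta_r}$, one for each coset of $\mathbb{Z}$ in $\mathbb{R}$ that contains an entry of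 $\vec\gamma$; each block has the form $\beta+C_\beta=(\beta+z_1,\dots,\beta+z_k)$ with $z_i\in\mathbb{Z}_{\ge0}$, $z_1\le\dots\le z_k$, where $\beta=0$, or $\beta=\tfrac12$, or $\beta\in(x+\tfrac12,x+1)$ for some $x\in\mathbb{Z}$. (Every $W$-orbit in $\mathbb{R}^n$ contains such a vector.) Put $Z(\vec\gamma)=\{\alpha\in R^+\mid\langle\vec\gamma,\alpha\rangle=0\}$, $P(\vec\gamma)=\{\alpha\in R\mid\langle\vec\gamma,\alpha\rangle=1\}$ and, for $J\subseteq P(\vec\gamma)$, $\mathcal{F}^{(\vec\gamma,J)}=\{w\in WC_n\mid R(w)\cap Z(\vec\gamma)=\emptyset,\ R(w)\cap P(\vec\gamma)=J\}$. Every root in $P(\vec\gamma)$ involves only indices $i$ from a single block; $P_\beta$ denotes the set of roots of $P(\vec\gamma)$ involving only indices of the block $\beta+C_\beta$, so $P(\vec\gamma)=\bigcup_\beta P_\beta$, and $J_\beta=J\cap P_\beta$. Book of placed configurations. There is one page for each block $\beta$. On each page boxes are placed on diagonals (running northwest to southeast, indexed increasingly from bottom left to top right; two diagonals are adjacent if their indices differ by $1$); on each diagonal the boxes are arranged with indices increasing from top left to bottom right. Boxes on adjacent diagonals are placed relative to each other, northwest (strictly north and weakly west) or southeast (weakly south and strictly east), as prescribed below; boxes may slide along diagonals, so only these relative positions matter. Below, $i,j$ in roots are positive indices of the block. Page $\beta\neq0,\tfrac12$: for each index $i$ of the block, $\mathrm{box}_i$ is on diagonal $\vec\gamma_i-\beta$.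 Here $P_\beta=\{\varepsilon_j-\varepsilon_i\mid j>i,\ \mathrm{box}_i,\mathrm{box}_j\text{ in adjacent diagonals}\}$. If $\varepsilon_j-\varepsilon_i\in J_\beta$, then $\mathrm{box}_j$ is northwest of $\mathrm{box}_i$; if $\varepsilon_j-\varepsilon_i\in P_\beta\setminus J_\beta$, then $\mathrm{box}_j$ is southeast of $\mathrm{box}_i$. Page $\tfrac12$: for each index $i$ of the block, $\mathrm{box}_i$ is on diagonal $\vec\gamma_i$ and $\mathrm{box}_{-i}$ on diagonal $-\vec\gamma_i$. Here $P_{1/2}$ consists of $\varepsilon_j-\varepsilon_i$ ($j>i$, boxes in adjacent diagonals), $\varepsilon_j+\varepsilon_i$ ($\mathrm{box}_i,\mathrm{box}_j$ both in diagonal $\tfrac12$), and $2\varepsilon_i$ ($\mathrm{box}_i$ in diagonal $\tfrac12$). If $\varepsilon_j-\varepsilon_i\in J_{1/2}$: $\mathrm{box}_j$ is northwest of $\mathrm{box}_i$ and $\mathrm{box}_{-i}$ is northwest of $\mathrm{box}_{-j}$; if $\varepsilon_j-\varepsilon_i\in P_{1/2}\setminus J_{1/2}$: the same with ''southeast''. For $j\ge i$ (with $\varepsilon_i+\varepsilon_i=2\varepsilon_i$), if $\varepsilon_j+\varepsilon_i\in J_{1/2}$: $\mathrm{box}_j$ is northwest of $\mathrm{box}_{-i}$ and $\mathrm{box}_i$ is northwest of $\mathrm{box}_{-j}$; if $\varepsilon_j+\varepsilon_i\in P_{1/2}\setminus J_{1/2}$: the same with ''southeast''. Page $0$: for each index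 $i$ of the block, if $\vec\gamma_i=0$ then $\mathrm{box}_i$ is on diagonal $0$ (and there is no $\mathrm{box}_{-i}$); if $\vec\gamma_i\ne0$ then $\mathrm{box}_i$ is on diagonal $\vec\gamma_i$ and $\mathrm{box}_{-i}$ on diagonal $-\vec\gamma_i$. Here $P_0$ consists of $\varepsilon_j-\varepsilon_i$ ($j>i$, boxes in adjacent diagonals) and $\varepsilon_j+\varepsilon_i$ ($\mathrm{box}_j$ in diagonal $1$, $\mathrm{box}_i$ in diagonal $0$). If $\varepsilon_j-\varepsilon_i\in J_0$: $\mathrm{box}_j$ is northwest of $\mathrm{box}_i$ and, if $\mathrm{box}_i$ is not on diagonal $0$, $\mathrm{box}_{-i}$ is northwest of $\mathrm{box}_{-j}$; if $\varepsilon_j-\varepsilon_i\in P_0\setminus J_0$: the same with ''southeast''. If $\varepsilon_j+\varepsilon_i\in J_0$ (with $\mathrm{box}_j$ in diagonal $1$, $\mathrm{box}_i$ in diagonal $0$): $\mathrm{box}_i$ is northwest of $\mathrm{box}_{-j}$; if $\varepsilon_j+\varepsilon_i\in P_0\setminus J_0$: $\mathrm{box}_i$ is southeast of $\mathrm{box}_{-j}$. Standard tableaux of the book. A standard tableau $t$ is a filling of all boxes of the book with elements of $\{-n,\dots,-1,1,\dots,n\}$ such that $|t(\mathrm{box}_1)|,\dots,|t(\mathrm{box}_n)|$ are distinct; $t(\mathrm{box}_{-i})=-t(\mathrm{box}_i)$ whenever $\mathrm{box}_{-i}$ exists; $t(\mathrm{box}_i)>0$ if $\mathrm{box}_i$ is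 on diagonal $0$ of page $0$; and on each page, for all (possibly negative) box indices $j>i$ of that page: (a) if $\mathrm{box}_i,\mathrm{box}_j$ are in the same diagonal, then $t(\mathrm{box}_i)<t(\mathrm{box}_j)$; (b) if they are in adjacent diagonals and $\mathrm{box}_j$ is northwest of $\mathrm{box}_i$, then $t(\mathrm{box}_i)>t(\mathrm{box}_j)$; (c) if they are in adjacent diagonals and $\mathrm{box}_j$ is southeast of $\mathrm{box}_i$, then $t(\mathrm{box}_i)<t(\mathrm{box}_j)$. The set of these is denoted $\mathcal{F}^{((C_{\beta_1},J_{\beta_1}),\dots,(C_{\beta_r},J_{\beta_r}))}$. *)

(* Defs.v *)
From HB Require Import structures.
From mathcomp Require Import all_boot all_order all_algebra all_fingroup.
From mathcomp Require Import all_classical all_reals.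

Set Implicit Arguments.
Unset Strict Implicit.
Unset Printing Implicit Defensive.

Import Order.TTheory GRing.Theory Num.Theory.
Local Open Scope classical_set_scope.
Local Open Scope ring_scope.

(** The set {-n, ..., -1, 1, ..., n}.  Since ['I_n] starts at 0, [(i, false)]
    stands for the integer i + 1 and [(i, true)] for -(i + 1). *)
Definition signed (n : nat) : Type := ('I_n * bool)%type.

Definition pos n (i : 'I_n) : signed n := (i, false).
Definition neg n (i : 'I_n) : signed n := (i, true).
Definition flip n (x : signed n) : signed n := (x.1, ~~ x.2).

Definition zval n (x : signed n) : int :=
  if x.2 then - (x.1.+1)%:Z else (x.1.+1)%:Z.

Definition WC n : set {perm signed n} :=
  [set w | forall x, w (flip x) = flip (w x)].

Section Roots.
Variables (R : realType) (n : nat).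
Implicit Types (u v : 'rV[R]_n) (w : {perm signed n}) (J : set 'rV[R]_n).

Definition dot u v : R := \sum_(i < n) u 0 i * v 0 i.

Definition eps (x : signed n) : 'rV[R]_n :=
  if x.2 then - delta_mx 0 x.1 else delta_mx 0 x.1.

Definition pos_roots : set 'rV[R]_n :=
  [set a | (exists i, a = 2 *: eps (pos i)) \/
           (exists i j : 'I_n, (i < j)%N /\
              (a = eps (pos j) + eps (pos i) \/
               a = eps (pos j) - eps (pos i)))].

Definition neg_roots : set 'rV[R]_n := [set a | pos_roots (- a)].

Definition roots : set 'rV[R]_n := pos_roots `|` neg_roots.

(** The linear action determined by [w eps_i = eps_(w i)]. *)
Definition act w v : 'rV[R]_n := \sum_(i < n) v 0 i *: eps (w (pos i)).

Definition inversions w : set 'rV[R]_n :=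
  [set a | pos_roots a /\ neg_roots (act w a)].

Definition Zset v : set 'rV[R]_n := [set a | pos_roots a /\ dot v a = 0].

Definition Pset v : set 'rV[R]_n := [set a | roots a /\ dot v a = 1].

Definition Fset v J : set {perm signed n} :=
  [set w | [/\ WC w, inversions w `&` Zset v = set0
             & inversions w `&` Pset v = J]].

End Roots.

(** The division of (1, ..., n) into consecutive nonempty blocks is given by
    the nondecreasing surjection [block]; the entries of block [p] are
    [beta p + offset i], for [i] with [block i = p]. *)
Record rearranged (R : realType) (n : nat) := Rearranged {
  nblocks : nat;
  block : 'I_n -> 'I_nblocks;
  beta : 'I_nblocks -> R;
  offset : 'I_n -> nat;
  block_mono : forall i j : 'I_n, (i <= j)%N -> (block i <= block j)%N;
  block_surj : forall p, exists i, block i = p;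
  beta_cosets : forall p q,
    (exists m : int, beta p - beta q = m%:~R) -> p = q;
  beta_range : forall p,
    [\/ beta p = 0, beta p = 2^-1
      | exists x : int, x%:~R + 2^-1 < beta p < x%:~R + 1];
  offset_sorted : forall i j : 'I_n,
    (i <= j)%N -> block i = block j -> (offset i <= offset j)%N
}.

Definition vec (R : realType) (n : nat) (g : rearranged R n) : 'rV[R]_n :=
  \row_i (beta (block g i) + (offset g i)%:R).

Inductive direction := NorthWest | SouthEast.

Section Book.
Variables (R : realType) (n : nat) (g : rearranged R n) (J : set 'rV[R]_n).
Implicit Types (i j : 'I_n) (x y : signed n) (p : 'I_(nblocks g)).

Definition page x : 'I_(nblocks g) := block g x.1.

Definition has_box x : bool :=
  ~~ x.2 || (beta (page x) == 2^-1)
         || ((beta (page x) == 0) && (vec g 0 x.1 != 0)).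

Definition box : Type := {x : signed n | has_box x}.

Definition pos_box i : box := exist has_box (pos i) isT.

(** Only meaningful when [has_box x]; diagonals are numbered by elements of
    Z, except on page 1/2, where they are numbered by elements of 1/2 + Z. *)
Definition diag x : R :=
  if (beta (page x) == 0) || (beta (page x) == 2^-1)
  then (if x.2 then - vec g 0 x.1 else vec g 0 x.1)
  else vec g 0 x.1 - beta (page x).

Definition adjacent x y : Prop := `|diag x - diag y| = 1.

Definition Ppage p : set 'rV[R]_n :=
  [set a | Pset (vec g) a /\ forall i, a 0 i != 0 -> block g i = p].

Definition Jpage p : set 'rV[R]_n := J `&` Ppage p.

(** The roots of page [p] that prescribe a relative position [d]. *)
Definition prescribes (d : direction) p : set 'rV[R]_n :=
  if d is NorthWest then Jpage p else Ppage p `\` Jpage p.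

(** [placed p d x y]: on page [p], box x is placed in direction [d] of box y.
    Boxes slide along diagonals, so a configuration is this relation only,
    not a choice of coordinates. *)
Inductive placed p (d : direction) : signed n -> signed n -> Prop :=
| placed_generic i j of beta p != 0 & beta p != 2^-1 &
    prescribes d p (eps R (pos j) - eps R (pos i)) :
    placed p d (pos j) (pos i)
| placed_half_minus i j of beta p = 2^-1 &
    prescribes d p (eps R (pos j) - eps R (pos i)) :
    placed p d (pos j) (pos i)
| placed_half_minus_neg i j of beta p = 2^-1 &
    prescribes d p (eps R (pos j) - eps R (pos i)) :
    placed p d (neg i) (neg j)
| placed_half_plus i j of beta p = 2^-1 & (i <= j)%N &
    prescribes d p (eps R (pos j) + eps R (pos i)) :
    placed p d (pos j) (neg i)
| placed_half_plus_neg i j of beta p = 2^-1 & (i <= j)%N &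
    prescribes d p (eps R (pos j) + eps R (pos i)) :
    placed p d (pos i) (neg j)
| placed_zero_minus i j of beta p = 0 &
    prescribes d p (eps R (pos j) - eps R (pos i)) :
    placed p d (pos j) (pos i)
| placed_zero_minus_neg i j of beta p = 0 & diag (pos i) != 0 &
    prescribes d p (eps R (pos j) - eps R (pos i)) :
    placed p d (neg i) (neg j)
| placed_zero_plus i j of beta p = 0 &
    diag (pos j) = 1 & diag (pos i) = 0 &
    prescribes d p (eps R (pos j) + eps R (pos i)) :
    placed p d (pos i) (neg j).

Record standard (t : {ffun box -> signed n}) : Prop := Standard {
  std_abs : forall i j,
    `|zval (t (pos_box i))| = `|zval (t (pos_box j))| -> i = j;
  std_neg : forall i (h : has_box (neg i)),
    t (exist has_box (neg i) h) = flip (t (pos_box i));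
  std_zero : forall i, beta (block g i) = 0 -> diag (pos i) = 0 ->
    0 < zval (t (pos_box i));
  std_diag : forall x y : box, page (val x) = page (val y) ->
    zval (val x) < zval (val y) -> diag (val x) = diag (val y) ->
    zval (t x) < zval (t y);
  std_nw : forall (p : 'I_(nblocks g)) (x y : box),
    page (val x) = p -> page (val y) = p ->
    zval (val x) < zval (val y) -> adjacent (val x) (val y) ->
    placed p NorthWest (val y) (val x) -> zval (t y) < zval (t x);
  std_se : forall (p : 'I_(nblocks g)) (x y : box),
    page (val x) = p -> page (val y) = p ->
    zval (val x) < zval (val y) -> adjacent (val x) (val y) ->
    placed p SouthEast (val y) (val x) -> zval (t x) < zval (t y)
}.

Definition tableaux : set {ffun box -> signed n} := [set t | standard t].

Definition odd_ext (t : {ffun box -> signed n}) x : signed n :=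
  if x.2 then flip (t (pos_box x.1)) else t (pos_box x.1).

Lemma odd_ext_inj (t : tableaux) : injective (odd_ext (val t)).
Proof.
have abs_zval (x : signed n) : `|zval x| = (x.1.+1)%:Z.
  by rewrite /zval; case: x.2; rewrite ?normrN.
have [abs_inj _ _ _ _ _] := set_valP t.
move=> [i a] [j b] e.
have fst_ext k c : (odd_ext (val t) (k, c)).1 = (val t (pos_box k)).1.
  by rewrite /odd_ext; case: c.
have ij : i = j by apply: abs_inj; rewrite !abs_zval -(fst_ext i a) e fst_ext.
move: e; rewrite -{}ij /odd_ext /flip; case: (val t _) => k c /=.
by case: a; case: b => //= -[]; case: c.
Qed.

(** Elements of the Weyl group are determined by their values on 1, ..., n. *)
Definition weyl (t : tableaux) : {perm signed n} := perm (@odd_ext_inj t).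

Lemma weyl_pos (t : tableaux) i : weyl t (pos i) = val t (pos_box i).
Proof. by rewrite permE. Qed.

Lemma weyl_WC (t : tableaux) : WC (weyl t).
Proof.
move=> [i b]; rewrite !permE /odd_ext /flip.
by case: b; case: (val t _) => k [].
Qed.

End Book.

Arguments tableaux {R n} g J.
Arguments weyl {R n g J} t.

(* Main.v *)
Require Import Defs.
From HB Require Import structures.
From mathcomp Require Import all_boot all_order all_algebra all_fingroup.
From mathcomp Require Import all_classical all_reals.
From mathcomp Require Import zify ring lra.

Set Implicit Arguments.
Unset Strict Implicit.
Unset Printing Implicit Defensive.

Import Order.TTheory GRing.Theory Num.Theory.
Local Open Scope classical_set_scope.
Local Open Scope ring_scope.

(** The positive roots are the differences eps_x - eps_y over signed indices
    x > y, and w inverts such a root exactly when w x < w y.  With gamma extended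
    oddly to signed indices, membership of w in F^(gamma,J) says that w x > w y
    when x > y and gamma_x = gamma_y, and that, when gamma_x - gamma_y = 1,
    w x < w y if and only if eps_x - eps_y lies in J.  Since
    eps_x - eps_y = eps_(-y) - eps_(-x), it suffices to impose the second
    condition on one of the pairs (x, y), (-y, -x), and at least one of them
    consists of two boxes whose relative position the book prescribes. *)

(** * Signed indices and negation *)

Section SignedIndices.
Variable n : nat.
Implicit Types (x y : signed n) (w : {perm signed n}).

Lemma flipK : involutive (@flip n).
Proof. by case=> i b; rewrite /flip /= negbK. Qed.

Lemma zval_flip x : zval (flip x) = - zval x.
Proof. by case: x => i []; rewrite /zval /= ?opprK. Qed.

Lemma zval_inj : injective (@zval n).
Proof.
move=> [i b] [j c]; rewrite /zval /= => e.
have /val_inj-> : (i : nat) = j by case: b c e => -[]; lia.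
by congr pair; case: b c e => -[]; lia.
Qed.

Lemma abs_zval x : `|zval x| = (x.1.+1)%:Z.
Proof. by rewrite /zval; case: x.2; lia. Qed.

Lemma zval_flip_lt x y : (zval (flip x) < zval (flip y)) = (zval y < zval x).
Proof. by rewrite !zval_flip ltrN2. Qed.

Lemma zval_pos_lt (i j : 'I_n) : (zval (pos i) < zval (pos j)) = (i < j)%N.
Proof. by rewrite /zval /=; lia. Qed.

Lemma zval_neg_lt_pos (i j : 'I_n) : zval (neg i) < zval (pos j).
Proof. by rewrite /zval /=; lia. Qed.

Lemma WC_neg w (i : 'I_n) : WC w -> w (neg i) = flip (w (pos i)).
Proof. by move=> wW; rewrite -wW. Qed.

End SignedIndices.

(** * Positive roots as differences over signed indices, and inversions *)

Section Roots.
Variables (R : realType) (n : nat).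
Implicit Types (x y : signed n) (u v a : 'rV[R]_n) (w : {perm signed n}).

Definition root x y : 'rV[R]_n := eps R x - eps R y.

Lemma eps_flip x : eps R (flip x) = - eps R x.
Proof. by case: x => i []; rewrite /eps /= ?opprK. Qed.

Lemma root_flip x y : root (flip x) (flip y) = root y x.
Proof. by rewrite /root !eps_flip opprK addrC. Qed.

Lemma opp_root x y : - root x y = root y x.
Proof. by rewrite /root opprB. Qed.

Lemma dotB u v a : dot u (v - a) = dot u v - dot u a.
Proof.
by rewrite /dot -sumrB; apply: eq_bigr => i _; rewrite !mxE mulrBr.
Qed.

Lemma dot_eps u x : dot u (eps R x) = if x.2 then - u 0 x.1 else u 0 x.1.
Proof.
rewrite /dot (bigD1 x.1) //= big1 ?addr0 => [|i ne]; last first.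
  by case: x ne => k [] /= ne; rewrite !mxE (negPf ne) ?oppr0 mulr0.
by case: x => k [] /=; rewrite !mxE !eqxx ?mulrN mulr1.
Qed.

Lemma root_supp x y (i : 'I_n) : root x y 0 i != 0 -> i = x.1 \/ i = y.1.
Proof.
have [-> | nx] := eqVneq i x.1; first by left.
have [-> | ny] := eqVneq i y.1; first by right.
move: nx ny; case: x y => k [] [l []] /= nx ny;
  by rewrite /root /eps /= !mxE (negPf nx) (negPf ny) andbF !(oppr0, addr0)
    eqxx.
Qed.

(** The long root 2 eps_i comes from the pair (i, -i) and the sum eps_j + eps_i from (j, -i), so all
    families of positive roots become differences. *)
Lemma pos_rootsP a :
  pos_roots a <-> exists x y, zval y < zval x /\ a = root x y.
Proof.
split=> [[[i ->] | [i [j [ij [] ->]]]] | [[i b] [[j c] [lt ->]]]].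
- exists (pos i), (neg i); split; first exact: zval_neg_lt_pos.
  by rewrite scaler_nat mulr2n /root /eps /= opprK.
- exists (pos j), (neg i); split; first exact: zval_neg_lt_pos.
  by rewrite /root /eps /= opprK.
- by exists (pos j), (pos i); split; rewrite ?zval_pos_lt.
case: b c lt => -[] lt; rewrite /root /eps /=.
- right; exists i, j; split; first by move: lt; rewrite /zval /=; lia.
  by right; rewrite opprK addrC.
- by move: lt; rewrite /zval /=; lia.
- rewrite opprK; have [ij | ji | /val_inj->] := ltngtP i j.
  + by right; exists i, j; split=> //; left; rewrite addrC.
  + by right; exists j, i; split=> //; left.
  + by left; exists j; rewrite scaler_nat mulr2n.
- by right; exists j, i; split; [rewrite -zval_pos_lt | right].
Qed.

(* The functional sending [eps x] to [zval x] is positive on positive roots. *)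
Lemma pos_roots_root x y : pos_roots (root x y) <-> zval y < zval x.
Proof.
split=> [/pos_rootsP[x' [y' [lt e]]] | lt]; last first.
  by apply/pos_rootsP; exists x, y.
pose h : 'rV[R]_n := \row_i (i.+1)%:R.
have hE z : dot h (eps R z) = (zval z)%:~R.
  by rewrite dot_eps !mxE /zval; case: z.2; rewrite ?mulrNz.
have := congr1 (dot h) e; rewrite !dotB !hE -!rmorphB /= => /intr_inj.
lia.
Qed.

Lemma actB w u v : Defs.act w (u - v) = Defs.act w u - Defs.act w v.
Proof.
by rewrite /Defs.act -sumrB; apply: eq_bigr => i _; rewrite !mxE scalerBl.
Qed.

Lemma act_eps w x : WC w -> Defs.act w (eps R x) = eps R (w x).
Proof.
move=> wW; rewrite /Defs.act (bigD1 x.1) //= big1 ?addr0 => [|i ne]; last first.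
  by case: x ne => k [] /= ne; rewrite !mxE (negPf ne) ?oppr0 scale0r.
case: x => k [] /=; rewrite !mxE !eqxx ?scaleN1r ?scale1r //.
by rewrite -/(neg k) WC_neg // eps_flip.
Qed.

(** By linearity [w] sends [root x y] to [root (w x) (w y)], whose opposite is
    [root (w y) (w x)]. *)
Lemma inversions_root w x y : WC w ->
  inversions w (root x y) <-> zval y < zval x /\ zval (w x) < zval (w y).
Proof.
move=> wW; rewrite /inversions /neg_roots /= actB !act_eps //.
by rewrite -/(root _ _) opp_root !pos_roots_root.
Qed.

End Roots.

(** * The odd extension of gamma and its integral differences *)

Section Rearranged.
Variables (R : realType) (n : nat) (g : rearranged R n).
Implicit Types (x y : signed n) (i j : 'I_n).

Definition coord x : R := if x.2 then - vec g 0 x.1 else vec g 0 x.1.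

Lemma coord_flip x : coord (flip x) = - coord x.
Proof. by case: x => i []; rewrite /coord /= ?opprK. Qed.

Lemma dot_root x y : dot (vec g) (root R x y) = coord x - coord y.
Proof. by rewrite dotB !dot_eps. Qed.

Lemma coord_neg i : coord (neg i) = - coord (pos i). Proof. by []. Qed.

Lemma coord_pos i : coord (pos i) = beta (block g i) + (offset g i)%:R.
Proof. by rewrite /coord mxE. Qed.

Lemma coord_sub_int i j (m : int) :
  coord (pos i) - coord (pos j) = m%:~R -> block g i = block g j.
Proof.
rewrite !coord_pos => e; apply: (@beta_cosets _ _ g).
exists (m - (offset g i)%:Z + (offset g j)%:Z).
by rewrite rmorphD rmorphB /= -e; ring.
Qed.

(* For [beta] in (x + 1/2, x + 1), [2 beta] is never an integer, and two such
   representatives have fractional parts summing to more than 1. *)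
Lemma coord_add_int i j (m : int) :
  coord (pos i) + coord (pos j) = m%:~R ->
  block g i = block g j /\
  (beta (block g i) = 0 \/ beta (block g i) = 2^-1).
Proof.
rewrite !coord_pos => e.
have {e} [k e] : exists k : int, beta (block g i) + beta (block g j) = k%:~R.
  exists (m - (offset g i)%:Z - (offset g j)%:Z).
  by rewrite !rmorphB /= -e; ring.
(* The integer [k] cannot lie strictly between consecutive integers; the argument given to [nint]
   below is the floor of the sum of the two [beta]. *)
have nint (x : int) : x%:~R < (k%:~R : R) -> (k%:~R : R) < (x + 1)%:~R -> False.
  by rewrite !ltr_int; lia.
have eqb : beta (block g i) = beta (block g j) -> block g i = block g j.
  by move=> eb; apply: (@beta_cosets _ _ g); exists 0; rewrite eb subrr.
case: (beta_range (block g i)) (beta_range (block g j)) =>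
    [bi|bi|[x /andP[xi ix]]] [bj|bj|[y /andP[yj jy]]].
- by split; [apply: eqb; rewrite bi | left].
- by case: (nint 0); rewrite -e ?intrD; lra.
- by case: (nint y); rewrite -e ?intrD; lra.
- by case: (nint 0); rewrite -e ?intrD; lra.
- by split; [apply: eqb; rewrite bi | right].
- by case: (nint (y + 1)); rewrite -e ?intrD; lra.
- by case: (nint x); rewrite -e ?intrD; lra.
- by case: (nint (x + 1)); rewrite -e ?intrD; lra.
- by case: (nint (x + y + 1)); rewrite -e ?intrD; lra.
Qed.

Lemma coord_int_block x y (m : int) :
  coord x - coord y = m%:~R -> block g x.1 = block g y.1.
Proof.
case: x y => i [] [j []];
  rewrite -?/(neg i) -?/(neg j) -?/(pos i) -?/(pos j) ?coord_neg => e /=.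
- by apply: (@coord_sub_int _ _ (- m)); rewrite rmorphN /= -e; ring.
- have [] // := @coord_add_int i j (- m).
  by rewrite rmorphN /= -e; ring.
- by have [] // := @coord_add_int i j m; rewrite -e; ring.
- exact: coord_sub_int e.
Qed.

Lemma beta_le_coord i : beta (block g i) <= coord (pos i).
Proof. by rewrite coord_pos lerDl ler0n. Qed.

(** This puts P(gamma) inside R^+. For equal signs the sorted offsets of a block decide. With [x]
    negative and [y] positive, two coordinates would sum to -1, but then [beta] is 0 or 1/2 and both
    are nonnegative. *)
Lemma coord_step_lt x y : coord x - coord y = 1 -> zval y < zval x.
Proof.
have pp i j : coord (pos i) - coord (pos j) = 1 -> (j < i)%N.
  move=> e; have b := @coord_sub_int _ _ 1 e; rewrite ltnNge; apply/negP=> ij.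
  have := offset_sorted ij b; rewrite leqNgt => /negP; apply.
  by move: e; rewrite !coord_pos b -(ltr_nat R); lra.
case: x y => i [] [j []];
  rewrite -?/(neg i) -?/(neg j) -?/(pos i) -?/(pos j) ?coord_neg => e.
- rewrite -zval_flip_lt /flip /= zval_pos_lt; apply: pp.
  by rewrite -e; ring.
- have [|eb bb] := @coord_add_int i j (- 1); first by rewrite -e; ring.
  exfalso; move: (beta_le_coord i) (beta_le_coord j) e.
  by rewrite -eb; case: bb => ->; lra.
- exact: zval_neg_lt_pos.
- by rewrite zval_pos_lt; apply: pp.
Qed.

Lemma Pset_root x y : Pset (vec g) (root R x y) <-> coord x - coord y = 1.
Proof.
rewrite /Pset /= dot_root; split=> [[]//|e]; split=> //.
by left; apply/pos_roots_root/coord_step_lt.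
Qed.

Lemma PsetP (a : 'rV[R]_n) : Pset (vec g) a ->
  exists x y, a = root R x y /\ coord x - coord y = 1.
Proof.
case=> -[/pos_rootsP[x [y [_ ->]]]|/pos_rootsP[x [y [_ e]]]].
  by rewrite dot_root => xy; exists x, y.
by rewrite -(opprK a) e opp_root dot_root => yx; exists y, x.
Qed.

Lemma Ppage_root x y :
  coord x - coord y = 1 -> Ppage (block g x.1) (root R x y).
Proof.
move=> e; split; first exact/Pset_root.
by move=> i /root_supp[] -> //; rewrite (@coord_int_block x y 1).
Qed.

End Rearranged.

(** * Placements in the book and membership in F^(gamma,J) *)

Section Book.
Variables (R : realType) (n : nat) (g : rearranged R n) (J : set 'rV[R]_n).
Implicit Types (x y : signed n) (i j : 'I_n) (d : direction).
Implicit Types (p : 'I_(nblocks g)) (w : {perm signed n}).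
Implicit Types (t : {ffun box g -> signed n}).

(** A form of [prescribes] without the page: when the coordinates differ by 1 the root lies in
    P(gamma) and [x] determines its page. *)
Definition status d x y : Prop :=
  if d is NorthWest then J (root R x y) else ~ J (root R x y).

(* The order forced on the entries a, b of two boxes on adjacent diagonals when
   the box of a, of larger index, is in direction d of the box of b. *)
Definition entry_order d (a b : int) : bool :=
  if d is NorthWest then a < b else b < a.

Lemma prescribes_status d p x y :
  prescribes J d p (root R x y) -> coord g x - coord g y = 1 /\ status d x y.
Proof.
case: d => /= -[]; first by move=> Jxy [/Pset_root].
by move=> Pxy nJ; split=> [|Jxy]; [case: Pxy => /Pset_root | apply: nJ].
Qed.

Lemma status_prescribes d x y : coord g x - coord g y = 1 -> status d x y ->
  prescribes J d (block g x.1) (root R x y).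
Proof.
by move=> /Ppage_root Pxy; case: d => /= Jxy; split=> // -[].
Qed.

(** Since eps_(-i) = -eps_i, all the rules of [placed] are instances of one: the prescribing root is
    the difference attached to the two boxes. *)
Lemma placed_prescribes d p x y :
  placed J p d x y -> prescribes J d p (root R x y).
Proof.
by case=> *; rewrite /root -?[neg _]/(flip (pos _)) ?eps_flip ?opprK //
  addrC.
Qed.

Lemma diag_coord x : beta (page g x) = 0 \/ beta (page g x) = 2^-1 ->
  diag g x = coord g x.
Proof. by rewrite /diag => -[] ->; rewrite eqxx ?orbT. Qed.

(** On pages 0 and 1/2 diagonals are coordinates; on the others only positive indices have boxes and
    the shift by [beta] cancels. *)
Lemma diag_sub x y : has_box g x -> has_box g y -> page g x = page g y ->
  diag g x - diag g y = coord g x - coord g y.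
Proof.
rewrite /has_box => + + pxy; rewrite -pxy.
have [b0|b0] := eqVneq (beta (page g x)) 0.
  by rewrite !diag_coord -?pxy //; left.
have [b2|b2] := eqVneq (beta (page g x)) 2^-1.
  by rewrite !diag_coord -?pxy //; right.
rewrite !orbF /diag /coord -pxy (negPf b0) (negPf b2) /=.
by move=> /negPf-> /negPf->; ring.
Qed.

Lemma placed_pos d p i j :
  prescribes J d p (root R (pos j) (pos i)) -> placed J p d (pos j) (pos i).
Proof.
have [b0|b0] := eqVneq (beta p) 0; first exact: placed_zero_minus.
have [b2|b2] := eqVneq (beta p) 2^-1; first exact: placed_half_minus.
exact: placed_generic.
Qed.

(* The configuration records a root [root x y] either through the boxes x, y
   or through the boxes -y, -x. *)
Lemma status_placed d x y : coord g x - coord g y = 1 -> status d x y ->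
  [/\ has_box g x, has_box g y & placed J (block g x.1) d x y] \/
  [/\ has_box g (flip y), has_box g (flip x)
     & placed J (block g x.1) d (flip y) (flip x)].
Proof.
move=> e /(status_prescribes e) pr.
case: x y e pr => i [] [j []] e.
- move=> pr; right; split=> //; apply: placed_pos.
  by rewrite -root_flip.
- by have := coord_step_lt e; rewrite ltNge ltW ?zval_neg_lt_pos.
- rewrite /root -[(j, true)]/(flip (pos j)) eps_flip opprK => pr /=.
  move: (e); rewrite -[(j, true)]/(neg j) coord_neg opprK => e1.
  have [/= eb [b0|b2]] := @coord_add_int _ _ _ _ _ 1 e1; last first.
    left; split; rewrite // /has_box /page /= -?eb ?b2 ?eqxx ?orbT //.
    (* The two rules for sums on page 1/2 are stated for ordered indices, so the order of [i] and
       [j] chooses between them. *)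
    have [ji|ij] := leqP j i; first exact: placed_half_plus.
    by apply: placed_half_plus_neg => //; [exact: ltnW | rewrite addrC].
  have bj : beta (block g j) = 0 by rewrite -eb.
  (* On page 0 the offsets sum to 1, so one index is on diagonal 0 and has no negative box. The pair
     to use is the one that negates the index on diagonal 1. *)
  move: e1; rewrite /flip !coord_pos b0 bj !add0r -natrD => /eqP.
  rewrite -[1]/(1%:R) eqr_nat; case oi: (offset g i) => [|[|?]] // /eqP oj.
    have {}oj : offset g j = 1%N by move: oj; lia.
    left; split; rewrite // ?/has_box /= ?mxE ?/page /= ?bj ?oj ?eqxx ?orbT //.
      by rewrite add0r oner_eq0 orbT.
    apply: placed_zero_plus => //; last by rewrite addrC.
      by rewrite diag_coord ?coord_pos /page /= bj ?oj ?add0r //; left.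
    by rewrite diag_coord ?coord_pos /page /= b0 ?oi ?add0r //; left.
  have {}oj : offset g j = 0%N by move: oj; lia.
  right; split; rewrite // ?/has_box /= ?mxE ?/page /= ?b0 ?oi ?eqxx ?orbT //.
    by rewrite add0r oner_eq0 orbT.
  apply: placed_zero_plus => //.
    by rewrite diag_coord ?coord_pos /page /= b0 ?oi ?add0r //; left.
  by rewrite diag_coord ?coord_pos /page /= bj ?oj ?add0r //; left.
- by move=> pr; left; split=> //; apply: placed_pos.
Qed.

(** Every root of Z(gamma) or P(gamma) is a [root x y] with [zval y < zval x], so both intersections
    become comparisons of pairs; J inside P(gamma) ensures this for the roots of [J]. *)
Lemma FsetP w : J `<=` Pset (vec g) ->
  Fset (vec g) J w <->
  [/\ WC w,
      forall x y, zval y < zval x -> coord g x = coord g y ->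
        zval (w y) < zval (w x)
    & forall d x y, coord g x - coord g y = 1 -> status d x y ->
        entry_order d (zval (w x)) (zval (w y))].
Proof.
move=> JP; split=> [[wW wZ wP] | [wW wZ wP]].
  have nlt x y : zval y < zval x -> ~ (zval (w x) < zval (w y)) ->
      zval (w y) < zval (w x).
    move=> yx /negP; rewrite -leNgt le_eqVlt => /orP[/eqP/zval_inj/perm_inj|//].
    by move=> e; move: yx; rewrite e ltxx.
  split=> // [x y yx e | d x y e].
    apply: nlt => // wxy; rewrite -[False]/(set0 (root R x y)) -wZ; split.
      exact/inversions_root.
    by split; [exact/pos_roots_root | rewrite dot_root e subrr].
  have yx := coord_step_lt e; case: d => /= [|nJ].
    by rewrite -wP => -[/inversions_root[]].
  apply: nlt => // wxy; apply: nJ; rewrite -wP; split; last exact/Pset_root.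
  exact/inversions_root.
split=> //; apply/seteqP; split=> // a.
- move=> [ia [/pos_rootsP[x [y [yx ea]]] az]]; move: ia az; rewrite {}ea.
  move=> /(inversions_root _ _ _ wW)[_ wxy]; rewrite dot_root => /eqP.
  rewrite subr_eq0 => /eqP/(wZ _ _ yx); lia.
- move=> [ia /[dup] Pa /PsetP[x [y [ea e]]]]; apply: contrapT => nJ.
  move: ia nJ; rewrite ea => /(inversions_root _ _ _ wW)[_ wxy].
  move=> /(wP SouthEast _ _ e) /=; lia.
- move=> Ja; split; last exact: JP.
  have [x [y [ea e]]] := PsetP (JP _ Ja); move: Ja; rewrite ea => Ja.
  apply/inversions_root => //; split; first exact: coord_step_lt e.
  exact: (wP NorthWest).
Qed.

Lemma odd_ext_flip t x : odd_ext t (flip x) = flip (odd_ext t x).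
Proof. by case: x => i []; rewrite /odd_ext //= flipK. Qed.

(** * Comparisons satisfied by a standard tableau *)

Section Standard.
Variables (t : {ffun box g -> signed n}) (tstd : standard J t).

Lemma odd_ext_box x (h : has_box g x) : t (exist _ x h) = odd_ext t x.
Proof.
case: x h => i [] h; first exact: (std_neg tstd).
by congr (t _); apply: val_inj.
Qed.

Lemma standard_zero x y : zval y < zval x -> coord g x = coord g y ->
  zval (odd_ext t y) < zval (odd_ext t x).
Proof.
have pp i j : (j < i)%N -> coord g (pos i) = coord g (pos j) ->
    zval (odd_ext t (pos j)) < zval (odd_ext t (pos i)).
  move=> ji e; have b : block g i = block g j.
    by apply: (@coord_sub_int _ _ _ _ _ 0); rewrite e subrr.
  have ed : diag g (pos j) = diag g (pos i).
    by apply/eqP; rewrite -subr_eq0 diag_sub // e subrr.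
  move: ji; rewrite -zval_pos_lt => ji.
  exact: (@std_diag _ _ _ _ _ tstd (pos_box g j) (pos_box g i)).
case: x y => i [] [j []]; rewrite -?/(neg i) -?/(neg j) -?/(pos i) -?/(pos j).
- rewrite -[neg i]/(flip (pos i)) -[neg j]/(flip (pos j)) !odd_ext_flip.
  rewrite !zval_flip_lt !coord_flip zval_pos_lt => ij /oppr_inj e.
  exact: pp.
- by rewrite ltNge ltW ?zval_neg_lt_pos.
(* Opposite signs force two coordinates of sum 0. Both are at least [beta], so they vanish on page
   0, where the entries are positive. *)
- move=> _ e; have [|eb bb] := @coord_add_int _ _ g i j 0.
    by rewrite e coord_neg addNr.
  suff [[b0 di] [b0' dj]] :
      (beta (block g i) = 0 /\ diag g (pos i) = 0) /\
      (beta (block g j) = 0 /\ diag g (pos j) = 0).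
    have := std_zero tstd b0 di; have := std_zero tstd b0' dj.
    rewrite -[neg j]/(flip (pos j)) odd_ext_flip zval_flip.
    rewrite /odd_ext /=; lia.
  rewrite !diag_coord /page /= -?eb //.
  have := beta_le_coord g i; have := beta_le_coord g j; move: e.
  by rewrite coord_neg -eb; case: bb => ->; lra.
- by rewrite zval_pos_lt; apply: pp.
Qed.

Lemma standard_placed d p x y : has_box g x -> has_box g y ->
  page g x = p -> page g y = p -> placed J p d x y ->
  entry_order d (zval (odd_ext t x)) (zval (odd_ext t y)).
Proof.
move=> hx hy xp yp /[dup] pl /placed_prescribes/prescribes_status[e _].
have lt := coord_step_lt e.
have adj : adjacent g y x.
  by rewrite /adjacent distrC diag_sub ?xp ?yp // e normr1.
rewrite -(odd_ext_box hx) -(odd_ext_box hy); case: d pl => pl /=.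
  exact: (@std_nw _ _ _ _ _ tstd p (exist _ y hy) (exist _ x hx)).
exact: (@std_se _ _ _ _ _ tstd p (exist _ y hy) (exist _ x hx)).
Qed.

Lemma standard_one d x y : coord g x - coord g y = 1 -> status d x y ->
  entry_order d (zval (odd_ext t x)) (zval (odd_ext t y)).
Proof.
move=> e; have b := @coord_int_block _ _ _ _ _ 1 e.
case/(status_placed e) => -[h1 h2 pl].
  by apply: standard_placed pl.
(* When the placed boxes are -y and -x, oddness of the filling carries their comparison back to [x]
   and [y]. *)
have := standard_placed h1 h2 (esym b) erefl pl.
by rewrite !odd_ext_flip; case: (d) => /=; rewrite zval_flip_lt.
Qed.

End Standard.

(** * The tableau of a Weyl group element *)

Definition tableau_of w : {ffun box g -> signed n} := [ffun b => w (val b)].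

Lemma tableau_of_standard w : J `<=` Pset (vec g) -> Fset (vec g) J w ->
  standard J (tableau_of w).
Proof.
move=> JP /(FsetP _ JP)[wW wZ wP].
split=> [i j | i h | i b0 di | x y pxy xy dxy | p x y _ _ _ _ | p x y _ _ _ _];
  rewrite !ffunE /=.
- rewrite !abs_zval => -[] /val_inj e.
  have : w (pos i) = w (pos j) \/ w (pos i) = w (neg j).
    rewrite WC_neg //; case: (w _) (w _) e => k b [l c] /= ->.
    by case: b; case: c; rewrite /flip /=; [left|right|right|left].
  by case=> /perm_inj[].
- exact: WC_neg.
(* On diagonal 0 the indices i and -i share the coordinate 0, so w(-i) < w(i), which means w(i) >
   0. *)
- have := wZ (pos i) (neg i) (zval_neg_lt_pos _ _).
  rewrite WC_neg // zval_flip coord_neg.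
  move: di; rewrite diag_coord; last by left.
  move=> -> /(_ (esym (oppr0 _))); lia.
- apply: wZ => //; apply/eqP; rewrite -subr_eq0 -diag_sub ?dxy ?subrr //;
    exact: valP.
- by move=> /placed_prescribes/prescribes_status[e /(wP NorthWest _ _ e)].
- by move=> /placed_prescribes/prescribes_status[e /(wP SouthEast _ _ e)].
Qed.

End Book.

Theorem theorem5p7 (R : realType) (n : nat) (g : rearranged R n)
    (J : set 'rV[R]_n) (hJ : J `<=` Pset (vec g)) :
  set_bij [set: tableaux g J] (Fset (vec g) J) weyl.
Proof.
split=> [t _ | t u _ _ tu | w wF].
- apply/FsetP => //; have tstd : standard J (val t) := set_valP t.
  split=> [|x y|d x y]; first exact: weyl_WC; rewrite !permE.
    exact: (standard_zero tstd).
  exact: (standard_one tstd).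
(* Every entry of a standard tableau, negative boxes included, is a value of its odd extension. *)
- apply: val_inj; apply/ffunP => -[x h].
  rewrite (odd_ext_box (set_valP t)) (odd_ext_box (set_valP u)).
  by move/permP/(_ x): tu; rewrite !permE.
- have wstd : tableaux g J (tableau_of g w) by exact: tableau_of_standard.
  exists (SigSub (mem_set wstd)) => //.
  have [wW _ _] := wF.
  apply/permP => -[i b]; rewrite permE /odd_ext /= ffunE /=.
  by case: b => //; rewrite -[RHS]/(w (neg i)) WC_neg.
Qed.
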